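(* Let $n \ge 1$ be an integer and let $t$ be a positive integer. For any distinct real numbers $0 < \epsilon_1, \dots, \epsilon_n < 1$, $$H_n(t) = \frac{1}{(2\pi i)^n} \int_{|z_1| = \epsilon_1} \cdots \int_{|z_n| = \epsilon_n} (z_1 \cdots z_n)^{-t-1} \left( \sum_{k=1}^n \frac{z_k^{t+n-1}}{\prod_{j \neq k} (z_k - z_j)} \right)^n dz_n \cdots dz_1 ,$$ where in the product $j$ ranges over $\{1,\dots,n\}\setminus\{k\}$.
   Context: The $n$-th Birkhoff polytope $\mathcal{B}_n \subset \mathbb{R}^{n^2}$ is the set of all real $n \times n$ matrices $(x_{jk})$ with $x_{jk} \ge 0$ for all $j,k$ and with every row sum and every column sum equal to $1$. Its Ehrhart counting function is $H_n(t) = \#\left(t\mathcal{B}_n \cap \mathbb{Z}^{n^2}\right)$, i.e. the number of $n \times n$ matrices with nonnegative integer entries in which every row and every column sums to $t$. Each integral $\int_{|z_k| = \epsilon_k}$ is a complex contour integral over the circle of radius $\epsilon_k$ centered at $0$, traversed once counterclockwise. *)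

(* Defs.v *)
From mathcomp Require Export all_boot all_order all_algebra finmap.
From mathcomp Require Export all_classical all_reals all_analysis.
From mathcomp Require Export complex.

Set Implicit Arguments.
Unset Strict Implicit.
Unset Printing Implicit Defensive.

Export Order.TTheory GRing.Theory Num.Theory.
Export numFieldNormedType.Exports.

Local Open Scope classical_set_scope.
Local Open Scope ring_scope.
Local Open Scope complex_scope.

Definition birkhoff (R : realType) (n : nat) : set 'M[R]_n :=
  [set x : 'M[R]_n | [/\ forall j k, 0 <= x j k,
               forall j, \sum_k x j k = 1 &
               forall k, \sum_j x j k = 1]].

(* [fset_set] sends an infinite set to the empty one, so this is the number of
   lattice points of the dilate [t P] only for bounded [P], such as polytopes. *)
Definition ehrhart (R : realType) (n : nat) (P : set 'M[R]_n) (t : nat) : nat :=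
  #|` fset_set ([set t%:R *: x | x in P] `&`
                [set x : 'M[R]_n | forall j k, x j k \is a Num.int]) |%fset.

Definition birkhoff_count (R : realType) (n t : nat) : nat := ehrhart (@birkhoff R n) t.

Definition Cintegral (R : realType) (a b : R) (f : R -> R[i]) : R[i] :=
  (\int[lebesgue_measure]_(x in `[a, b]) complex.Re (f x)) +i*
  (\int[lebesgue_measure]_(x in `[a, b]) complex.Im (f x)).

(* The integral over the circle |w| = e, parametrized counterclockwise by
   w = e exp(i s), dw = i e exp(i s) ds, for s in [0, 2 pi]. *)
Definition circle_integral (R : realType) (e : R) (f : R[i] -> R[i]) : R[i] :=
  Cintegral 0 (2 * pi) (fun s =>
    let w := e%:C * (cos s +i* sin s) in f w * ('i * w)).

(* The variable of index 0 is the outermost one. *)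
Fixpoint torus_integral (R : realType) (n : nat) :
    ('I_n -> R) -> (n.-tuple R[i] -> R[i]) -> R[i] :=
  match n with
  | 0 => fun _ f => f [tuple]
  | m.+1 => fun eps f =>
      circle_integral (eps ord0) (fun w =>
        torus_integral (fun k : 'I_m => eps (lift ord0 k))
                       (fun z => f [tuple of w :: z]))
  end.

(* Main.v *)
Require Import Defs.
From mathcomp Require Import all_boot all_order all_algebra.
From mathcomp Require Import all_classical all_reals all_analysis complex.
From mathcomp Require Import ring.

(* Since the radii are distinct, so are the z_k on the torus, and the inner sum
   is the divided difference of x^(t+n-1) at z_1, ..., z_n, that is the complete
   homogeneous symmetric polynomial h_t(z).  The coefficient of (z_1 ... z_n)^t
   in h_t(z)^n counts the matrices with all row and column sums t: the j-th
   factor contributes a monomial whose exponent is the j-th row.  Integrating a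
   Laurent polynomial over the torus extracts that coefficient. *)

Local Open Scope ring_scope.
Local Open Scope complex_scope.

(** * Divided differences of powers as complete homogeneous symmetric polynomials *)

Section DividedDifference.
Set Implicit Arguments.
Unset Strict Implicit.
Variable F : fieldType.
Implicit Types (x y : F) (s : seq F).

Definition divdiff p s : F :=
  \sum_(x <- s) x ^+ p / \prod_(y <- s | y != x) (x - y).

Lemma perm_divdiff p s1 s2 : perm_eq s1 s2 -> divdiff p s1 = divdiff p s2.
Proof.
move=> s12; rewrite /divdiff (perm_big _ s12)/=.
by apply: eq_bigr => x _; rewrite (perm_big _ s12).
Qed.

(** At a node y other than x, y^(p+1) / (y - x) = y^p + x y^p / (y - x). This is the Leibniz rule
    for the product of the identity and the p-th power. *)
Lemma divdiffS p x s : uniq (x :: s) ->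
  divdiff p.+1 (x :: s) = divdiff p s + x * divdiff p (x :: s).
Proof.
move=> /andP[xs us]; rewrite /divdiff !big_cons mulrDr mulrA -exprS.
rewrite [RHS]addrCA; congr (_ + _); rewrite mulr_sumr -big_split/=.
apply: eq_big_seq => y ys; rewrite big_cons.
have xy : x != y by apply: contraNneq xs => ->.
rewrite xy; set P := \prod_(_ <- _ | _) _.
have P0 : P != 0.
  by rewrite prodf_seq_neq0; apply/allP => z _; rewrite subr_eq0 eq_sym; apply/implyP.
by rewrite exprS; field; rewrite P0 subr_eq0 eq_sym.
Qed.

Lemma divdiff0 s : uniq s -> divdiff 0 s = (size s == 1)%:R.
Proof.
(* Expanding the divided difference of x^1 at x, y, ... by removing either x or y
   gives (x - y) * divdiff 0 (x :: y :: s) = 0. *)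
have [n] := ubnP (size s); elim: n s => // n IHn [|x [|y s]] /=.
- by rewrite /divdiff big_nil.
- by rewrite /divdiff big_seq1 big_cons big_nil eqxx divr1.
rewrite ltnS => sn uxys; have perm_xy : perm_eq (x :: y :: s) (y :: x :: s).
  by rewrite (perm_catCA [:: x] [:: y]).
have uyxs : uniq (y :: x :: s) by rewrite -(perm_uniq perm_xy).
have := divdiffS 0 uxys; rewrite !(perm_divdiff _ perm_xy) (divdiffS 0 uyxs).
have /andP[_ uys] := uxys; have /andP[_ uxs] := uyxs.
rewrite (IHn (x :: s))// (IHn (y :: s))//= => /addrI/eqP.
rewrite -subr_eq0 -mulrBl mulf_eq0 subr_eq0.
move: uxys; rewrite /= !inE negb_or -andbA eq_sym => /andP[/negPf->] _.
by move=> /eqP.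
Qed.

(* Modulo ['X^(t + 1)] this is 1 / (1 - x 'X), so that the coefficients of a
   product of such polynomials are the h_p for p <= t. *)
Definition geom t x : {poly F} := \poly_(j < t.+1) x ^+ j.

(** The geometric recurrence [geom] = 1 + x 'X [geom] fails only by the term x^(t+1) 'X^(t+1), which
    reaches no coefficient of index at most t. *)
Lemma coef_geomM t x (P : {poly F}) p : (p <= t)%N ->
  (geom t x * P)`_p = P`_p + x * ('X * (geom t x * P))`_p.
Proof.
move=> pt; have geomE : geom t x = 1 + x *: ('X * geom t x) - x ^+ t.+1 *: 'X^(t.+1).
  apply/polyP => i; rewrite coefB coefD !coefZ coefXM coefXn coef1 !coef_poly.
  case: i => [|i]/=; first by rewrite expr0 !mulr0 addr0 subr0.
  rewrite ltnS eqSS; case: (ltngtP i t) => it; rewrite add0r.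
  - by rewrite ltnS (ltnW it) mulr0 subr0 exprS.
  - by rewrite ltnS leqNgt it /= !mulr0 subr0.
  - by rewrite it leqnn mulr1 exprS subrr.
rewrite [in LHS]geomE mulrBl mulrDl mul1r coefB coefD -!scalerAl !coefZ mulrA.
by rewrite coefXnM ltnS pt mulr0 subr0.
Qed.

(** By induction on the nodes, then on [p]: both sides obey the recurrence of [divdiffS]. The power
    of 'X accounts for the vanishing of the divided difference when p < size s - 1. *)
Lemma divdiff_coef t s p : uniq s -> (0 < size s)%N -> (p < t + size s)%N ->
  divdiff p s = ('X^((size s).-1) * \prod_(x <- s) geom t x)`_p.
Proof.
elim: s p => // x s IHs p uxs _; have /andP[xs us] := uxs.
have [s0|s0] := posnP (size s).
  rewrite (size0nil s0)/= addn1 ltnS expr0 mul1r big_seq1 coef_poly ltnS => ->.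
  by rewrite /divdiff big_seq1 big_cons big_nil eqxx divr1.
elim: p => [_|p IHp pt].
  by rewrite divdiff0//= coefXnM s0 eqSS; case: (size s) s0.
rewrite divdiffS// IHp ?(ltnW pt)// IHs//; last by rewrite -ltnS -addnS.
rewrite /= !big_cons; move: pt s0 => /=; set G := geom t x * _.
case: (size s) => // m; rewrite !addnS !ltnS => pt _.
rewrite !coefXnM ltnS /= subSS !ltnS; case: (ltnP p m) => [mp|mp].
  by rewrite (ltnW mp) mulr0 addr0.
(* The bound on [p] puts the shifted index in the range where truncation at degree t does not
   disturb the recurrence of [geom]. *)
have pmt : (p - m <= t)%N by rewrite leq_subLR addnC.
rewrite /G (coef_geomM _ _ pmt) coefXM subn_eq0.
by case: ltngtP mp => // mp _; rewrite ?mp// subnS.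
Qed.

(* The exponents are bounded by [t] only to range over a finite type. *)
Lemma divdiff_complete n t (z : n.-tuple F) : (0 < n)%N -> injective (tnth z) ->
  \sum_k tnth z k ^+ (t + n - 1) / \prod_(j | j != k) (tnth z k - tnth z j) =
  \sum_(f : {ffun 'I_n -> 'I_t.+1} | (\sum_k f k)%N == t) \prod_k tnth z k ^+ f k.
Proof.
move=> n0 z_inj; have uz : uniq z.
  by rewrite -[tval z](map_tnth_enum z) map_inj_uniq ?enum_uniq.
transitivity (divdiff (t + n - 1) z).
  rewrite /divdiff big_tuple; apply: eq_bigr => k _; congr (_ / _).
  by rewrite big_tuple; apply: eq_bigl => j; rewrite (inj_eq z_inj).
rewrite (@divdiff_coef t) ?size_tuple//; last by rewrite subn1 ltn_predL addn_gt0 n0 orbT.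
(* The factor 'X^(n - 1) lowers the index t + n - 1 to t. Expanding the product then chooses one
   exponent per variable, with total t. *)
rewrite -addnBA// subn1 coefXnM ltnNge leq_addl/= addnK.
have geomE x : geom t x = \sum_(j < t.+1) x ^+ j *: 'X^j by exact: poly_def.
rewrite big_tuple (eq_bigr _ (fun k _ => geomE (tnth z k))) bigA_distr_bigA/=.
rewrite coef_sum [RHS]big_mkcond/=; apply: eq_bigr => f _.
rewrite scaler_prod coefZ prodrXr coefXn eq_sym.
by case: eqP => _; rewrite ?mulr1 ?mulr0.
Qed.
End DividedDifference.

(** * Integrals of Laurent polynomials over circles and tori *)

Section CircleIntegral.
Set Implicit Arguments.
Unset Strict Implicit.
Variable R : realType.

Lemma Rintegral_prim (f F : R -> R) (a b : R) : a < b ->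
  continuous f -> (forall x, is_derive x (1:R) F (f x)) ->
  \int[lebesgue_measure]_(x in `[a, b]) f x = F b - F a.
Proof.
move=> ab cf dF; have cF : continuous F.
  by move=> x; apply/differentiable_continuous/derivable1_diffP; case: (dF x).
rewrite /Rintegral (@continuous_FTC2 _ _ F)//.
- exact: continuous_subspaceT.
- split=> [x _||]; first by case: (dF x).
  + exact/cvg_at_right_filter/cF.
  + exact/cvg_at_left_filter/cF.
- by move=> x _; rewrite derive1E; apply: derive_val.
Qed.

(** Stated on real and imaginary parts, as [Cintegral] is; continuity of the derivative is included
    for the fundamental theorem of calculus. *)
Definition is_prim (F f : R -> R[i]) :=
  [/\ continuous (fun s => complex.Re (f s)), continuous (fun s => complex.Im (f s)),
      forall s, is_derive s (1:R) (fun s => complex.Re (F s)) (complex.Re (f s)) &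
      forall s, is_derive s (1:R) (fun s => complex.Im (F s)) (complex.Im (f s))].

Lemma Cintegral_prim (F f : R -> R[i]) (a b : R) : a < b -> is_prim F f ->
  Cintegral a b f = F b - F a.
Proof.
move=> ab [cr ci dr di]; rewrite /Cintegral (Rintegral_prim ab cr dr).
by rewrite (Rintegral_prim ab ci di); case: (F a) (F b) => ? ? [].
Qed.

Lemma is_prim0 : is_prim (fun=> 0) (fun=> 0).
Proof. by split=> /= s; [apply: cst_continuous..| |]; apply: is_derive_cst. Qed.

Lemma is_primD F1 f1 F2 f2 : is_prim F1 f1 -> is_prim F2 f2 ->
  is_prim (fun s => F1 s + F2 s) (fun s => f1 s + f2 s).
Proof.
move=> [cr1 ci1 dr1 di1] [cr2 ci2 dr2 di2].
have ReD (g h : R -> R[i]) : (fun s => complex.Re (g s + h s)) =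
    (fun s => complex.Re (g s)) + (fun s => complex.Re (h s)).
  by apply/funext => s; rewrite fctE; case: (g s) (h s) => ? ? [].
have ImD (g h : R -> R[i]) : (fun s => complex.Im (g s + h s)) =
    (fun s => complex.Im (g s)) + (fun s => complex.Im (h s)).
  by apply/funext => s; rewrite fctE; case: (g s) (h s) => ? ? [].
rewrite /is_prim !ReD !ImD; split=> s.
- by apply: continuousD; [apply: cr1|apply: cr2].
- by apply: continuousD; [apply: ci1|apply: ci2].
- have -> : complex.Re (f1 s + f2 s) = complex.Re (f1 s) + complex.Re (f2 s).
    by case: (f1 s) (f2 s) => ? ? [].
  exact: is_deriveD.
- have -> : complex.Im (f1 s + f2 s) = complex.Im (f1 s) + complex.Im (f2 s).
    by case: (f1 s) (f2 s) => ? ? [].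
  exact: is_deriveD.
Qed.

Lemma eq_is_prim F1 f1 F2 f2 : F1 =1 F2 -> f1 =1 f2 ->
  is_prim F1 f1 -> is_prim F2 f2.
Proof. by move=> /funext<- /funext<-. Qed.

Lemma is_prim_sum (I : finType) (P : pred I) (F f : I -> R -> R[i]) :
  (forall i, is_prim (F i) (f i)) ->
  is_prim (fun s => \sum_(i | P i) F i s) (fun s => \sum_(i | P i) f i s).
Proof.
move=> Ff; rewrite /index_enum; elim: (Finite.enum I) => [|i r IHr].
  by apply: (eq_is_prim _ _ is_prim0) => s; rewrite big_nil.
case: (boolP (P i)) => Pi.
  by apply: (eq_is_prim _ _ (is_primD (Ff i) IHr)) => s; rewrite big_cons Pi.
by apply: (eq_is_prim _ _ IHr) => s; rewrite big_cons (negPf Pi).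
Qed.

Definition expi (s : R) : R[i] := cos s +i* sin s.

Lemma expi0 : expi 0 = 1. Proof. by rewrite /expi cos0 sin0. Qed.

Lemma expiD s1 s2 : expi (s1 + s2) = expi s1 * expi s2.
Proof. by rewrite /expi cosD sinD; apply/eqP; rewrite eq_complex /= eqxx/= addrC. Qed.

Lemma norm_expi s : `|expi s| = 1.
Proof. by rewrite normc_def /= cos2Dsin2 sqrtr1. Qed.

Lemma expi_neq0 s : expi s != 0.
Proof. by rewrite -normr_eq0 norm_expi oner_eq0. Qed.

Lemma expi_exprz s (k : int) : expi s ^ k = expi (k%:~R * s).
Proof.
have expiX n : expi s ^+ n = expi (n%:R * s).
  by elim: n => [|n IHn]; rewrite ?mul0r ?expi0// exprS IHn -expiD mulrSr mulrDl mul1r addrC.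
case: k => [n|n]; first by rewrite -exprnP expiX.
apply: (mulfI (expf_neq0 n.+1 (expi_neq0 s))); rewrite NegzE -exprnN divff.
  by rewrite expiX -expiD rmorphN/= mulNr subrr expi0.
by rewrite expf_neq0 ?expi_neq0.
Qed.

Lemma expi_int (k : int) : expi (k%:~R * (2 * pi)) = 1.
Proof.
by rewrite -expi_exprz /expi mulr_natl cos2pi sin2pi complexr0 exp1rz.
Qed.

Lemma is_prim_expi (m : R) (c : R[i]) : m != 0 ->
  is_prim (fun s => c / (m%:C * 'i) * expi (m * s)) (fun s => c * expi (m * s)).
Proof.
move=> m0; case: c => a b.
have dm (x : R) : is_derive x (1:R) ( *%R m) m.
  by apply: is_derive_eq; rewrite /= /GRing.scale/= mulr1.
have dsin (x : R) : is_derive x (1:R) (sin \o *%R m) (cos (m * x) * m).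
  by apply: is_derive1_comp.
have dcos (x : R) : is_derive x (1:R) (cos \o *%R m) (- sin (m * x) * m).
  by apply: is_derive1_comp.
have csin : continuous (sin \o *%R m).
  by move=> x; apply/differentiable_continuous/derivable1_diffP; case: (dsin x).
have ccos : continuous (cos \o *%R m).
  by move=> x; apply/differentiable_continuous/derivable1_diffP; case: (dcos x).
(* Division by m i swaps the two parts up to sign, which leaves real combinations of cos and sin to
   differentiate. *)
have divE : (a +i* b) / (m%:C * 'i) = (b / m) +i* (- (a / m)).
  apply: (mulIf (_ : m%:C * 'i != 0)).
    by rewrite eq_complex /= !mul0r !mulr0 mulr1 subr0 addr0 negb_and m0 orbT.
  rewrite divfK.
    by apply/eqP; rewrite eq_complex /=; apply/andP; split; apply/eqP; field.
  by rewrite eq_complex /= !mul0r !mulr0 mulr1 subr0 addr0 negb_and m0 orbT.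
rewrite /expi divE; split=> /= s.
- by apply: cvgB; apply: cvgM; (try exact: cvg_cst); [apply: ccos|apply: csin].
- by apply: cvgD; apply: cvgM; (try exact: cvg_cst); [apply: csin|apply: ccos].
- have := is_deriveB (is_deriveZ (b / m) (dcos s)) (is_deriveZ (- (a / m)) (dsin s)).
  by congr is_derive; rewrite /GRing.scale/=; field.
- have := is_deriveD (is_deriveZ (b / m) (dsin s)) (is_deriveZ (- (a / m)) (dcos s)).
  by congr is_derive; rewrite /GRing.scale/=; field.
Qed.

Lemma is_prim_cst (c : R[i]) : is_prim (fun s => c * s%:C) (fun=> c).
Proof.
case: c => a b; split=> /= s; first exact: cst_continuous.
- exact: cst_continuous.
- by under eq_fun do rewrite mulr0 subr0; apply: is_derive_eq; rewrite /GRing.scale/= mulr1.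
- by under eq_fun do rewrite mulr0 add0r; apply: is_derive_eq; rewrite /GRing.scale/= mulr1.
Qed.

(** With dw = i w ds, each term becomes a multiple of exp(i (a + 1) s), whose integral over a full
    turn vanishes by periodicity unless a = -1. *)
Lemma circle_integral_laurent (I : finType) (P : pred I) (e : R) (f : R[i] -> R[i])
    (c : I -> R[i]) (a : I -> int) : 0 < e ->
    (forall w, `|w| = e%:C -> f w = \sum_(i | P i) c i * w ^ a i) ->
  circle_integral e f =
    \sum_(i | P i) c i * (if a i == -1 then (2 * pi)%:C * 'i else 0).
Proof.
(* [C i] gathers the coefficient, the i of dw and the power of the radius; for a = -1 that power is
   1, so the radius disappears. *)
move=> e0 fE; pose C i := c i * 'i * e%:C ^ (a i + 1).
pose prim i s := if a i == -1 then C i * s%:C else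
  C i / (((a i + 1)%:~R)%:C * 'i) * expi ((a i + 1)%:~R * s).
have primP i : is_prim (prim i) (fun s => C i * expi ((a i + 1)%:~R * s)).
  rewrite /prim; case: eqP => [->|/eqP ai].
    by apply: (eq_is_prim _ _ (is_prim_cst _)) => // s; rewrite addNr mul0r expi0 mulr1.
  by apply: is_prim_expi; rewrite intr_eq0 addr_eq0.
have -> : circle_integral e f = Cintegral 0 (2 * pi)
    (fun s => \sum_(i | P i) C i * expi ((a i + 1)%:~R * s)).
  congr Cintegral; apply/funext => s /=; rewrite -/(expi s) fE; last first.
    by rewrite normrM norm_expi mulr1 normc_def /= expr0n addr0 sqrtr_sqr gtr0_norm.
  rewrite mulr_suml; apply: eq_bigr => i _.
  have e_neq0 : e%:C != 0 :> R[i] by rewrite eq_complex /= negb_and gt_eqF.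
  rewrite -expi_exprz exprzMl ?unitfE ?expi_neq0//.
  rewrite !expfzDr ?expi_neq0// !expr1z /C expfzDr// expr1z.
  by rewrite mulrACA -[RHS]mulrA; congr (_ * _); rewrite mulrACA.
rewrite (Cintegral_prim _ (is_prim_sum P primP)) ?mulr_gt0 ?pi_gt0//.
rewrite -sumrB; apply: eq_bigr => i _; rewrite /prim /C; case: eqP => [->|_].
  by rewrite addNr expr0z mulr1 mulr0 subr0 -mulrA ['i * _]mulrC.
by rewrite expi_int mulr0 expi0 subrr mulr0.
Qed.

(** By induction on n: the inner integral is again a Laurent polynomial in the outermost variable,
    whose coefficients carry the inner residues. *)
Lemma torus_integral_laurent (n : nat) (I : finType) (P : pred I) (eps : 'I_n -> R)
    (f : n.-tuple R[i] -> R[i]) (c : I -> R[i]) (a : I -> 'I_n -> int) :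
    (forall k, 0 < eps k) ->
    (forall z : n.-tuple R[i], (forall k, `|tnth z k| = (eps k)%:C) ->
      f z = \sum_(i | P i) c i * \prod_k tnth z k ^ a i k) ->
  torus_integral eps f =
    \sum_(i | P i) c i * \prod_k (if a i k == -1 then (2 * pi)%:C * 'i else 0).
Proof.
elim: n eps f c a => [|n IHn] eps f c a eps0 fE /=.
  by rewrite fE => [|[]//]; apply: eq_bigr => i _; rewrite !big_ord0.
rewrite (@circle_integral_laurent _ P _ _ (fun i => c i * \prod_(k < n)
  (if a i (lift ord0 k) == -1 then (2 * pi)%:C * 'i else 0)) (a^~ ord0))//.
  by apply: eq_bigr => i _; rewrite big_ord_recl mulrAC mulrA.
(* With w fixed, its power is absorbed into the coefficients to which the induction hypothesis
   applies. *)
move=> w wE; rewrite (IHn _ _ (fun i => c i * w ^ a i ord0) (fun i k => a i (lift ord0 k)))//.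
  by apply: eq_bigr => i _; rewrite mulrAC.
move=> z zE; rewrite fE.
  apply: eq_bigr => i _; rewrite big_ord_recl mulrA; congr (_ * _).
  by apply: eq_bigr => k _; rewrite tnthS.
by move=> k; case: (unliftP ord0 k) => [j|] ->; rewrite !(tnth_nth 0)//= -(tnth_nth 0) zE.
Qed.
End CircleIntegral.

(** * Lattice points of the dilated Birkhoff polytope *)

Section Count.
Set Implicit Arguments.
Unset Strict Implicit.

Lemma birkhoff_countE (R : realType) n t : (0 < t)%N ->
  birkhoff_count R n t =
  #|[pred g : {ffun 'I_n -> {ffun 'I_n -> 'I_t.+1}} |
     [forall j, (\sum_k g j k)%N == t] && [forall k, (\sum_j g j k)%N == t]]|.
Proof.
move=> t0; have tR0 : t%:R != 0 :> R by rewrite pnatr_eq0 -lt0n.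
set G := [pred g | _]; pose toM (g : {ffun 'I_n -> {ffun 'I_n -> 'I_t.+1}}) : 'M[R]_n :=
  \matrix_(j, k) (g j k)%:R.
have toM_inj : injective toM.
  move=> g1 g2 /matrixP g12; apply/ffunP => j; apply/ffunP => k; apply/val_inj.
  by have := g12 j k; rewrite !mxE => /eqP; rewrite eqr_nat => /eqP.
pose S := [fset toM g | g in G]%fset.
(* Once the set of lattice points is identified with the finite set [S], [fset_set] returns [S] and
   not its default value. *)
rewrite /birkhoff_count /ehrhart (_ : (_ `&` _)%classic = [set` S]%classic).
  by rewrite set_fsetK card_imfset//= -cardE.
apply/seteqP; split=> x /=.
  move=> [[y [y0 yr yc] <-{x}] yint].
  have rowE j : \sum_k t%:R *: y j k = t%:R by rewrite -scaler_sumr yr /GRing.scale/= mulr1.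
  (* An entry is a nonnegative integer bounded by its row sum t, so it fits in ['I_t.+1]. *)
  have yP j k : {m : 'I_t.+1 | t%:R * y j k = m%:R}.
    apply: cid; have /natrP[m mE] : t%:R * y j k \is a Num.nat.
      by rewrite natrEint mulr_ge0 ?ler0n// andbT; have := yint j k; rewrite mxE.
    have mt : (m < t.+1)%N.
      rewrite ltnS -(ler_nat R) -mE -[leRHS](rowE j) (bigD1 k)//= lerDl sumr_ge0// => i _.
      by rewrite mulr_ge0 ?ler0n.
    by exists (Ordinal mt).
  pose g := [ffun j => [ffun k => sval (yP j k)]].
  have gE j k : (g j k)%:R = t%:R * y j k by rewrite !ffunE; exact/esym/(svalP (yP j k)).
  apply/imfsetP; exists g; last by apply/matrixP => j k; rewrite !mxE gE.
  rewrite !inE; apply/andP; split; apply/forallP => j; rewrite -(eqr_nat R) natr_sum.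
    by under eq_bigr do rewrite gE; rewrite -mulr_sumr yr mulr1.
  by under eq_bigr do rewrite gE; rewrite -mulr_sumr yc mulr1.
move=> /imfsetP[g]; rewrite !inE => /andP[/forallP gr /forallP gc] ->; split.
  exists (t%:R^-1 *: toM g); last by rewrite scalerA divff// scale1r.
  split=> [j k|j|k].
  - by rewrite !mxE mulr_ge0 ?invr_ge0 ?ler0n.
  - under eq_bigr do rewrite !mxE; rewrite -mulr_sumr -natr_sum (eqP (gr j)).
    by rewrite mulVf.
  - under eq_bigr do rewrite !mxE; rewrite -mulr_sumr -natr_sum (eqP (gc k)).
    by rewrite mulVf.
by move=> j k; rewrite mxE natr_int.
Qed.
End Count.

(** * Extraction of the coefficient that counts the matrices *)

Theorem theorem2 (R : realType) (n t : nat) (eps : 'I_n -> R)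
    (hn : (1 <= n)%N) (ht : (0 < t)%N)
    (eps_gt0 : forall k, 0 < eps k) (eps_lt1 : forall k, eps k < 1)
    (eps_inj : injective eps) :
  ((birkhoff_count R n t)%:R : R[i]) =
    ((2 * pi)%:C * 'i) ^- n *
    torus_integral eps (fun z =>
      (\prod_k tnth z k) ^- t.+1 *
      (\sum_k tnth z k ^+ (t + n - 1) /
              \prod_(j | j != k) (tnth z k - tnth z j)) ^+ n).
Proof.
pose row_sums (g : {ffun 'I_n -> {ffun 'I_n -> 'I_t.+1}}) :=
  [forall j, (\sum_k g j k)%N == t].
(* The monomial of [g] has as exponent of z_k the k-th column sum, lowered by t + 1 by the
   prefactor. *)
rewrite (@torus_integral_laurent R n _ row_sums eps _ (fun=> 1)
  (fun g k => (\sum_j g j k)%N%:Z - t.+1%:Z))//; last first.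
  move=> z zE; have z_neq0 k : tnth z k != 0.
    by rewrite -normr_eq0 zE eq_complex /= negb_and gt_eqF.
  have z_inj : injective (tnth z).
    by move=> j k jk; apply: eps_inj; apply: complexI; rewrite -!zE jk.
  have powE (x : R[i]) : x ^+ n = \prod_(j < n) x by rewrite prodr_const card_ord.
  rewrite divdiff_complete// powE.
  (* Expanding the n-th power picks from the j-th factor an exponent vector [g j] of sum t, the j-th
     row of a matrix. *)
  rewrite (bigA_distr_big_dep _ (fun=> _)) /= mulr_sumr.
  apply: eq_big => [g|g _].
    by apply/familyP/forallP.
  rewrite mul1r exchange_big/= -prodrXl -prodfV -big_split/=.
  apply: eq_bigr => k _; rewrite prodrXr.
  by rewrite expfzDr// -exprnN mulrC.
have piI0 : (2 * pi)%:C * 'i != 0 :> R[i].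
  apply: mulf_neq0; rewrite eq_complex /= negb_and ?oner_eq0 ?orbT//.
  by rewrite lt0r_neq0// mulr_gt0 ?pi_gt0.
rewrite birkhoff_countE//.
pose col_sums (g : {ffun 'I_n -> {ffun 'I_n -> 'I_t.+1}}) :=
  [forall k, (\sum_j g j k)%N == t].
(* Exponent -1 in z_k means that column k sums to t; a matrix thus contributes (2 pi i)^n if all its
   columns do, and 0 otherwise. *)
rewrite (eq_bigr (fun g => ((2 * pi)%:C * 'i) ^+ n * (col_sums g)%:R)) => [|g _].
  rewrite -mulr_sumr mulKf ?expf_neq0// -natr_sum; congr _%:R.
  rewrite -sum1_card big_mkcond [RHS]big_mkcond/=.
  apply: eq_bigr => g _; rewrite inE -/(row_sums g) -/(col_sums g).
  by case: (row_sums g); case: (col_sums g).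
rewrite /= mul1r /col_sums.
have expE k : ((\sum_j g j k)%N%:Z - t.+1%:Z == -1) = ((\sum_j g j k)%N == t).
  by rewrite subr_eq intS addKr eqz_nat.
case: forallP => [g_col|g_col].
  rewrite mulr1 (eq_bigr (fun=> (2 * pi)%:C * 'i)) => [|k _]; last by rewrite expE g_col.
  by rewrite prodr_const card_ord.
rewrite mulr0; apply/eqP; rewrite prodf_seq_eq0; apply: contra_notT g_col => /hasPn nz k.
by have := nz k (mem_index_enum k); rewrite /= expE; case: (_ == t); rewrite ?eqxx.
Qed.
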